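(* Let $N\geq 2$ and $k\in\{1,\dots,N-1\}$. There is no one dimensional viscosity solution $u(x)=v(x_N)$ of $$\mathcal{P}^-_{k}(D^2u)+u-u^3=0\ \text{ in }\mathbb R^N,\qquad |u|<1\ \text{ in }\mathbb R^N,$$ which is (strictly) increasing in the $x_N$-direction.
   Context: For a real symmetric $N\times N$ matrix $X$ with ordered eigenvalues $\lambda_1(X)\leq\dots\leq\lambda_N(X)$, the truncated Laplacian is $\mathcal{P}^-_{k}(X)=\lambda_1(X)+\dots+\lambda_k(X)$. Points of $\mathbb R^N$ are written $x=(x_1,\dots,x_N)$. A function $u$ on $\mathbb R^N$ is one dimensional if $u(x)=v(x_N)$ for some $v:\mathbb R\to\mathbb R$. A viscosity solution is a continuous function $u:\mathbb R^N\to\mathbb R$ with $|u|<1$ such that, for every $\varphi\in C^2$ and every point $\hat x$: if $u-\varphi$ has a local maximum at $\hat x$ then $\mathcal{P}^-_{k}(D^2\varphi(\hat x))+u(\hat x)-u(\hat x)^3\geq 0$, and if $u-\varphi$ has a local minimum at $\hat x$ then $\mathcal{P}^-_{k}(D^2\varphi(\hat x))+u(\hat x)-u(\hat x)^3\leq 0$. The test functions $\varphi$ are functions of all $N$ variables and need not be one dimensional. *)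

(* Defs.v *)
From HB Require Import structures.
From mathcomp Require Import all_boot all_order all_algebra.
From mathcomp Require Import all_classical all_reals all_analysis.

Set Implicit Arguments.
Unset Strict Implicit.
Unset Printing Implicit Defensive.

Import Order.TTheory GRing.Theory Num.Theory.
Import numFieldNormedType.Exports.

Local Open Scope classical_set_scope.
Local Open Scope ring_scope.

Section TruncatedLaplacian.
Context {R : realType} {N : nat}.
Implicit Types (X : 'M[R]_N) (s : seq R).

Definition is_spectrum X s : Prop :=
  sorted <=%R s /\ char_poly X = \prod_(a <- s) ('X - a%:P).

(* The list lambda_1(X) <= ... <= lambda_N(X), indexed from 0.  The default
   [::] is returned only if char_poly X does not split over R, which does not
   happen for symmetric X. *)
Definition spectrum X : seq R := xget [::] [set s | is_spectrum X s].

Definition truncated_laplacian (k : nat) X : R :=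
  \sum_(0 <= i < k) (spectrum X)`_i.

End TruncatedLaplacian.

Section TestFunctions.
Context {R : realType} {N : nat}.
Implicit Types (f u phi : 'rV[R]_N -> R) (i j : 'I_N) (x y : 'rV[R]_N).

Definition basis_vec i : 'rV[R]_N := delta_mx 0 i.

Definition partial i f : 'rV[R]_N -> R := fun x => 'D_(basis_vec i) f x.

Definition C1 f : Prop :=
  continuous f /\
  forall i, (forall x, derivable f x (basis_vec i)) /\ continuous (partial i f).

Definition C2 f : Prop := C1 f /\ forall i, C1 (partial i f).

Definition hessian f x : 'M[R]_N := \matrix_(i, j) partial j (partial i f) x.

Definition local_max f x : Prop := \forall y \near x, f y <= f x.

Definition local_min f x : Prop := \forall y \near x, f x <= f y.

End TestFunctions.

Section Solutions.
Context {R : realType} {N : nat}.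
Implicit Types (k : nat) (u : 'rV[R]_N -> R) (i : 'I_N).

Definition viscosity_subsolution k u : Prop :=
  forall (phi : 'rV[R]_N -> R) (x : 'rV[R]_N), C2 phi ->
    local_max (fun y => u y - phi y) x ->
    truncated_laplacian k (hessian phi x) + u x - u x ^+ 3 >= 0.

Definition viscosity_supersolution k u : Prop :=
  forall (phi : 'rV[R]_N -> R) (x : 'rV[R]_N), C2 phi ->
    local_min (fun y => u y - phi y) x ->
    truncated_laplacian k (hessian phi x) + u x - u x ^+ 3 <= 0.

Definition viscosity_solution k u : Prop :=
  [/\ continuous u, forall x, `|u x| < 1,
      viscosity_subsolution k u & viscosity_supersolution k u].

Definition depends_only_on i u : Prop :=
  exists v : R -> R, forall x, u x = v (x 0 i).

Definition strictly_increasing_along i u : Prop :=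
  forall (x : 'rV[R]_N) (t : R), 0 < t -> u x < u (x + t *: basis_vec i).

End Solutions.

Fact last_coord_subproof (N : nat) (hN : (2 <= N)%N) : (N.-1 < N)%N.
Proof. by rewrite ltn_predL (ltn_trans _ hN). Qed.

(* The index of x_N in (x_1, ..., x_N): coordinates are numbered from 0. *)
Definition last_coord (N : nat) (hN : (2 <= N)%N) : 'I_N :=
  Ordinal (last_coord_subproof hN).

(* Main.v *)
(* Since k <= N - 1, the truncated Laplacian vanishes on the Hessian
   2a E_NN (a >= 0) of a convex quadratic in x_N.  Where v < 0, a parabola touches
   v from above, and the subsolution inequality v - v^3 >= 0 fails; so v >= 0,
   hence v > 0 by strict monotonicity.  A positive bounded increasing v is touched
   from below by an affine function of small slope, and there the supersolution
   inequality v - v^3 <= 0 fails. *)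
Require Import Defs.
From HB Require Import structures.
From mathcomp Require Import all_boot all_order all_algebra.
From mathcomp Require Import all_classical all_reals all_analysis.
From mathcomp Require Import ring lra.
Set Implicit Arguments.
Unset Strict Implicit.
Unset Printing Implicit Defensive.

Import Order.TTheory GRing.Theory Num.Theory.
Import numFieldNormedType.Exports.
Local Open Scope ring_scope.

(** * Spectra of diagonal matrices with a single nonzero entry *)

(** The head of [s] is a root of the right-hand product, hence occurs in [t]; its linear factor then
    cancels, since polynomials over [R] form an integral domain. *)
Lemma perm_eq_prod_XsubC (R : idomainType) (s t : seq R) :
  \prod_(a <- s) ('X - a%:P) = \prod_(a <- t) ('X - a%:P) -> perm_eq s t.
Proof.
elim: s t => [|a s IHs] t eq_st.
  by have := congr1 (fun p : {poly R} => size p) eq_st;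
    rewrite !size_prod_XsubC => -[/esym/size0nil ->].
have a_t : a \in t.
  by rewrite -root_prod_XsubC -eq_st root_prod_XsubC mem_head.
rewrite (perm_trans _ (_ : perm_eq (a :: rem a t) t)) //; last first.
  by rewrite perm_sym perm_to_rem.
rewrite perm_cons IHs //; apply: (mulfI (negbT (polyXsubC_eq0 a))).
by move: eq_st; rewrite (perm_big _ (perm_to_rem a_t)) !big_cons.
Qed.

(** The characteristic polynomial fixes the roots up to order and sorting fixes the order, so the
    choice made by [xget] is forced. *)
Lemma spectrum_eq (R : realType) (N : nat) (X : 'M[R]_N) (s : seq R) :
  is_spectrum X s -> spectrum X = s.
Proof.
move=> sX; have [sorted_s char_s] := sX; apply: (xget_unique [::] sX).
move=> t [sorted_t char_t].
apply: (sorted_eq le_trans le_anti) => //.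
by apply: perm_eq_prod_XsubC; rewrite -char_s -char_t.
Qed.

Lemma char_poly_scale_delta (R : comNzRingType) (N : nat) (i : 'I_N) (c : R) :
  char_poly (c *: delta_mx i i) = 'X^(N.-1) * ('X - c%:P).
Proof.
rewrite char_poly_trig; last first.
  apply/is_trig_mxP => j l lt_jl; rewrite !mxE.
  have [ji|_] := eqVneq j i; have [li|_] := eqVneq l i; rewrite ?mulr0 //.
  by move: lt_jl; rewrite ji li ltnn.
rewrite (bigD1 i) //= !mxE eqxx mulr1 mulrC; congr (_ * _).
rewrite (eq_bigr (fun=> 'X)) => [|j ne_ji]; last first.
  by rewrite !mxE (negPf ne_ji) mulr0 subr0.
by rewrite prodr_const cardC1 card_ord.
Qed.

(** As [c] is nonnegative it comes last in the sorted spectrum, after N - 1 zeros, and the [k < N]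
    smallest eigenvalues do not reach it. *)
Lemma truncated_laplacian_scale_delta (R : realType) (N k : nat) (i : 'I_N)
    (c : R) : 0 <= c -> (k < N)%N -> truncated_laplacian k (c *: delta_mx i i) = 0.
Proof.
move=> c_ge0 lt_kN.
rewrite /truncated_laplacian (@spectrum_eq _ _ _ (rcons (nseq N.-1 0) c)).
  rewrite big_nat big1 // => j /andP[_ lt_jk].
  have lt_jN : (j < N.-1)%N by case: N lt_kN {i} => // N; apply: leq_trans lt_jk.
  by rewrite nth_rcons size_nseq lt_jN nth_nseq lt_jN.
split; last first.
  by rewrite char_poly_scale_delta big_rcons /= big_nseq subr0 iter_mulr_1.
elim: N.-1 => //= -[|n] IHn //=; first by rewrite c_ge0.
by rewrite lexx.
Qed.

(** * Quadratics in one coordinate as test functions *)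

Section CoordinatePolynomials.
Context {R : realType} {N : nat} (i : 'I_N).
Implicit Types (a b c : R) (x v : 'rV[R]_N) (j : 'I_N).

Lemma is_derive_coord x v : is_derive x v (fun y : 'rV[R]_N => y 0 i) (v 0 i).
Proof.
apply: DeriveDef; first exact/diff_derivable/differentiable_coord.
rewrite /derive; apply/cvg_lim; first exact: norm_hausdorff.
(* The difference quotient equals [v 0 i] exactly for every nonzero [h]. *)
apply: cvg_near_cst.
apply: filterS (nbhs_dnbhs_neq 0) => h h_neq0.
by rewrite /= !mxE addrK /GRing.scale /= mulrA mulVf ?mul1r.
Qed.

Definition coord_quadratic a b c x : R := a * x 0 i ^+ 2 + b * x 0 i + c.

Lemma is_derive_coord_quadratic a b c x v :
  is_derive x v (coord_quadratic a b c) ((2 * a * x 0 i + b) * v 0 i).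
Proof.
have dx := is_derive_coord x v.
have := is_deriveD (is_deriveD (is_deriveZ a (is_deriveX 2 dx))
  (is_deriveZ b dx)) (is_derive_cst c x v).
by move/is_derive_eq; apply; rewrite /GRing.scale /=; ring.
Qed.

(** The family is stable under partial derivatives, so the regularity and the Hessian of its members
    follow from this one computation. *)
Lemma partial_coord_quadratic a b c j :
  partial j (coord_quadratic a b c) =
  coord_quadratic 0 (2 * a * (i == j)%:R) (b * (i == j)%:R).
Proof.
apply/funext => x; rewrite /partial /basis_vec.
have := is_derive_coord_quadratic a b c x (delta_mx 0 j).
by move=> ?; rewrite derive_val mxE eqxx /coord_quadratic; ring.
Qed.

Lemma continuous_coord_quadratic a b c : continuous (coord_quadratic a b c).
Proof.
move=> x; have cx := @coord_continuous R 1 N 0 i x.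
exact: cvgD (cvgD (cvgM (cvg_cst a) (cvgM cx cx))
  (cvgM (cvg_cst b) cx)) (cvg_cst c).
Qed.

Lemma C1_coord_quadratic a b c : C1 (coord_quadratic a b c).
Proof.
split=> [|j]; first exact: continuous_coord_quadratic.
rewrite partial_coord_quadratic; split; last exact: continuous_coord_quadratic.
by move=> x; have [] := is_derive_coord_quadratic a b c x (basis_vec j).
Qed.

Lemma C2_coord_quadratic a b c : C2 (coord_quadratic a b c).
Proof.
split=> [|j]; first exact: C1_coord_quadratic.
by rewrite partial_coord_quadratic; exact: C1_coord_quadratic.
Qed.

Lemma hessian_coord_quadratic a b c x :
  hessian (coord_quadratic a b c) x = (2 * a) *: delta_mx i i.
Proof.
apply/matrixP => j l; rewrite !mxE !partial_coord_quadratic /coord_quadratic.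
by rewrite [j == i]eq_sym [l == i]eq_sym; do 2!case: eqP => _ /=; ring.
Qed.

Lemma truncated_laplacian_coord_quadratic (k : nat) a b c x :
  0 <= a -> (k < N)%N ->
  truncated_laplacian k (hessian (coord_quadratic a b c) x) = 0.
Proof.
move=> a_ge0 lt_kN; rewrite hessian_coord_quadratic.
by rewrite truncated_laplacian_scale_delta ?mulr_ge0.
Qed.

End CoordinatePolynomials.

(** * Touching points on the line and the inequalities they give *)

(** A maximum over the compact interval is at least [f c], which exceeds both end values, so it is
    not attained at an end. This makes touching points genuine local extrema. *)
Lemma itv_interior_max (R : realType) (f : R -> R) (a b c : R) :
  continuous f -> a < c < b -> f a < f c -> f b < f c ->
  exists2 t, t \in `]a, b[ & forall s, s \in `]a, b[ -> f s <= f t.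
Proof.
move=> cf /andP[ac cb] fac fbc; have ab := lt_trans ac cb.
have [|t + fmax] := @EVT_max R f a b (ltW ab).
  exact: continuous_subspaceT.
have fct : f c <= f t by apply: fmax; rewrite in_itv /= !ltW.
rewrite in_itv /= => /andP[le_at le_tb]; exists t.
  rewrite in_itv /= !lt_neqAle le_at le_tb !andbT; apply/andP; split.
    by apply: contraTneq fct => <-; rewrite -ltNge.
  by apply: contraTneq fct => ->; rewrite -ltNge.
by move=> s; rewrite !in_itv /= => /andP[las lsb]; apply: fmax;
  rewrite in_itv /= !ltW.
Qed.

Lemma near_coord_itv (R : realType) (N : nat) (i : 'I_N) (a b : R)
    (x : 'rV[R]_N) :
  x 0 i \in `]a, b[ -> \forall y \near x, (y : 'rV[R]_N) 0 i \in `]a, b[.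
Proof.
by move=> xi; exact: (@coord_continuous R 1 N 0 i x _ (near_in_itvoo xi)).
Qed.

Section OneDimensional.
Context {R : realType} {N : nat} (i : 'I_N).
Implicit Types (k : nat) (u : 'rV[R]_N -> R) (v : R -> R).

Lemma continuous_profile u v :
  continuous u -> (forall x, u x = v (x 0 i)) -> continuous v.
Proof.
move=> cu uv.
(* The profile is the restriction of [u] to the [i]-th axis. *)
have -> : v = u \o (fun t => t *: basis_vec i).
  by apply/funext => t; rewrite /= uv !mxE !eqxx mulr1.
move=> t; apply: continuous_comp; last exact: cu.
by apply: cvgZr_tmp; exact: cvg_id.
Qed.

Lemma profile_increasing u v :
  strictly_increasing_along i u -> (forall x, u x = v (x 0 i)) ->
  {homo v : s t / s < t}.
Proof.
move=> iu uv s t st.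
have := iu (s *: basis_vec i) (t - s); rewrite subr_gt0 => /(_ st).
by rewrite !uv !mxE !eqxx !mulr1 addrC subrK.
Qed.

(** The operator vanishes on convex quadratics in coordinate [i], leaving only the zero-order terms;
    contact on an interval becomes contact on a slab, a neighbourhood of any point with [i]-th
    coordinate [t]. *)
Lemma subsolution_touched_above k u v a b c l r t :
  viscosity_subsolution k u -> (forall x, u x = v (x 0 i)) ->
  (k < N)%N -> 0 <= a -> t \in `]l, r[ ->
  (forall s, s \in `]l, r[ -> v s - (a * s ^+ 2 + b * s + c) <=
     v t - (a * t ^+ 2 + b * t + c)) ->
  0 <= v t - v t ^+ 3.
Proof.
move=> subu uv lt_kN a_ge0 t_lr tmax.
pose x : 'rV[R]_N := const_mx t; have xi : x 0 i = t by rewrite mxE.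
have := subu (coord_quadratic i a b c) x (C2_coord_quadratic i a b c).
rewrite truncated_laplacian_coord_quadratic // add0r uv xi; apply.
have : \forall y \near x, (y : 'rV[R]_N) 0 i \in `]l, r[.
  by apply: near_coord_itv; rewrite xi.
by apply: filterS => y /tmax; rewrite !uv /coord_quadratic xi.
Qed.

Lemma supersolution_touched_below k u v a b c l r t :
  viscosity_supersolution k u -> (forall x, u x = v (x 0 i)) ->
  (k < N)%N -> 0 <= a -> t \in `]l, r[ ->
  (forall s, s \in `]l, r[ -> v t - (a * t ^+ 2 + b * t + c) <=
     v s - (a * s ^+ 2 + b * s + c)) ->
  v t - v t ^+ 3 <= 0.
Proof.
move=> supu uv lt_kN a_ge0 t_lr tmin.
pose x : 'rV[R]_N := const_mx t; have xi : x 0 i = t by rewrite mxE.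
have := supu (coord_quadratic i a b c) x (C2_coord_quadratic i a b c).
rewrite truncated_laplacian_coord_quadratic // add0r uv xi; apply.
have : \forall y \near x, (y : 'rV[R]_N) 0 i \in `]l, r[.
  by apply: near_coord_itv; rewrite xi.
by apply: filterS => y /tmin; rewrite !uv /coord_quadratic xi.
Qed.

Lemma increasing_subsolution_ge0 k u v t0 :
  (k < N)%N -> (forall x, u x = v (x 0 i)) -> viscosity_subsolution k u ->
  continuous v -> {homo v : s t / s < t} -> (forall t, `|v t| < 1) ->
  0 <= v t0.
Proof.
move=> lt_kN uv subu cv iv v1; rewrite leNgt; apply/negP => vt0.
(* [v s - 3 (s - c)^2] is below -2 at both ends of [c - 1, c + 1]. *)
pose c := t0 - 1.
have [||||t t_itv tmax] := @itv_interior_max R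
    (fun s => v s - (3 * s ^+ 2 + (- 6 * c) * s + 3 * c ^+ 2)) (t0 - 2) t0 c.
- move=> s; apply: cvgB; first exact: cv.
  apply: cvgD; last exact: cvg_cst.
  by apply: cvgD; apply: cvgM;
    [exact: cvg_cst | exact: exprn_continuous | exact: cvg_cst | exact: cvg_id].
- by rewrite /c; apply/andP; split; lra.
- have /ltr_normlP[] := v1 (t0 - 2); have /ltr_normlP[] := v1 c.
  by rewrite /c; nra.
- have /ltr_normlP[] := v1 t0; have /ltr_normlP[] := v1 c.
  by rewrite /c; nra.
have := subsolution_touched_above subu uv lt_kN _ t_itv tmax.
move=> /(_ ltac:(lra)).
(* The interval ends at [t0], so [v t] lies in ]-1, 0[, where v - v^3 is negative. *)
have lt_vt : v t < v t0 by apply: iv; rewrite (itvP t_itv).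
have /ltr_normlP[] := v1 t; nra.
Qed.

Lemma increasing_supersolution_not_gt0 k u v :
  (k < N)%N -> (forall x, u x = v (x 0 i)) -> viscosity_supersolution k u ->
  continuous v -> {homo v : s t / s < t} -> (forall t, `|v t| < 1) ->
  ~ forall t, 0 < v t.
Proof.
move=> lt_kN uv supu cv iv v1 v_gt0.
(* The slope [s] is below that of the chord over [0, 1], and at [- s^-1] the
   line of slope [s] has dropped by 1 > v 0: hence [v - s r] is smaller at 0 than
   at both ends of [- s^-1, 1]. *)
pose s := (v 1 - v 0) / 2.
have s_gt0 : 0 < s by rewrite divr_gt0 // subr_gt0 iv.
have [||||t t_itv tmin] := @itv_interior_max R
    (fun r => - (v r - (0 * r ^+ 2 + s * r + 0))) (- s^-1) 1 0.
- move=> r; apply: cvgN; apply: cvgB; first exact: cv.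
  apply: cvgD; last exact: cvg_cst.
  by apply: cvgD; apply: cvgM;
    [exact: cvg_cst | exact: exprn_continuous | exact: cvg_cst | exact: cvg_id].
- by rewrite oppr_lt0 invr_gt0 s_gt0 ltr01.
- have /ltr_normlP[_] := v1 0; have := v_gt0 (- s^-1).
  by rewrite mulrN mulfV ?gt_eqF //; lra.
- by move: s_gt0; rewrite /s; lra.
have : v t - v t ^+ 3 <= 0.
  apply: (supersolution_touched_below supu uv lt_kN (lexx 0) t_itv
    (b := s) (c := 0)).
  by move=> r /tmin; rewrite lerN2.
(* On ]0, 1[ the term v - v^3 is positive. *)
have /ltr_normlP[_] := v1 t; have := v_gt0 t; nra.
Qed.

End OneDimensional.

Theorem mainTheorem2 (R : realType) (N k : nat) (hN : (2 <= N)%N)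
    (hk : (1 <= k <= N - 1)%N) :
  ~ exists u : 'rV[R]_N -> R,
      [/\ viscosity_solution k u,
          depends_only_on (last_coord hN) u &
          strictly_increasing_along (last_coord hN) u].
Proof.
have lt_kN : (k < N)%N.
  case/andP: hk => _ le_k; apply: leq_ltn_trans le_k _.
  by rewrite ltn_subrL (ltnW hN).
move=> [u [[cu u1 subu supu] [v uv] iu]].
have cv := continuous_profile cu uv.
have iv := profile_increasing iu uv.
have v1 t : `|v t| < 1.
  by have := u1 (const_mx t); rewrite uv mxE.
apply: (increasing_supersolution_not_gt0 lt_kN uv supu cv iv v1) => t.
apply: le_lt_trans (iv (t - 1) t _); last by rewrite ltrBlDr ltrDl.
exact: (increasing_subsolution_ge0 (t - 1) lt_kN uv subu cv iv v1).
Qed.
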